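(* Let $r>1$, $\rho\ge0$, let $\ell$ be slowly varying at infinity, and let $u:[0,\infty)\to[0,\infty)$ be measurable with $U(x)=\int_0^xu(y)\,\mathrm{d}y<\infty$ for all $x\ge0$. Assume that $u$ is ultimately monotone, and that for some $p\in\mathcal{P}_r$ $$\lim_{n\to\infty}\frac{U(r^nz)}{(r^nz)^\rho\,\ell(r^nz)}=p(z)\quad\text{for each } z\in C_p.$$ If $\rho>0$, then $p=\mathrm{B}_\rho p_0$ for some $p_0\in\mathcal{P}_r$. If $\rho=0$, let $p_0(x)\equiv0$. In both cases $$\lim_{n\to\infty}\frac{u(r^nz)}{(r^nz)^{\rho-1}\,\ell(r^nz)}=p_0(z)\quad\text{for each } z\in C_{p_0}.$$ Moreover, if $p_0$ is continuous, then $$u(x)\sim x^{\rho-1}\,\ell(x)\,p_0(x)\quad\text{as } x\to\infty,$$ where for $p_0\equiv0$ this relation means $u(x)=o(x^{\rho-1}\ell(x))$.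
   Context: A function $\ell:(0,\infty)\to(0,\infty)$ is slowly varying at infinity if it is measurable and $\ell(\lambda x)/\ell(x)\to1$ as $x\to\infty$ for every $\lambda>0$. A function is ultimately monotone if it is monotone (increasing or decreasing) on some half-line $[x_0,\infty)$. For $r>1$, $\mathcal{P}_r$ is the set of functions $p:(0,\infty)\to(0,\infty)$ that are bounded, right-continuous, satisfy $\inf_{x\in[1,r]}p(x)>0$, and $p(xr)=p(x)$ for all $x>0$. $C_p$ is the set of continuity points of $p$. For $\rho>0$ and $p\in\mathcal{P}_r$, $\mathrm{B}_\rho p(x)=x^{-\rho}\int_0^xy^{\rho-1}p(y)\,\mathrm{d}y$, $x>0$. $f\sim g$ means $f/g\to1$. *)

(* Defs.v *)
(* MathComp-Analysis.  A function with domain (0,oo) or [0,oo) is represented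
   by a total function R -> R of which only the values on that domain are
   ever used; "measurable" means Borel measurable. *)
From mathcomp Require Import all_boot all_order all_algebra.
From mathcomp Require Import all_classical all_reals all_analysis.

Set Implicit Arguments.
Unset Strict Implicit.
Unset Printing Implicit Defensive.

Import Order.TTheory GRing.Theory Num.Theory.
Import numFieldNormedType.Exports.
Local Open Scope classical_set_scope.
Local Open Scope ring_scope.

Definition slowly_varying (R : realType) (l : R -> R) : Prop :=
  [/\ forall x : R, 0 < x -> 0 < l x,
      measurable_fun (`]0, +oo[ : set R) l &
      forall lam : R, 0 < lam -> l (lam * x) / l x @[x --> +oo] --> (1 : R)].

Definition ultimately_monotone (R : realType) (u : R -> R) : Prop :=
  exists2 x0 : R, 0 <= x0 &
    {in `[x0, +oo[ &, {homo u : x y / x <= y}} \/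
    {in `[x0, +oo[ &, {homo u : x y /~ x <= y}}.

Definition log_periodic (R : realType) (r : R) (p : R -> R) : Prop :=
  [/\ forall x : R, 0 < x -> 0 < p x,
      [bounded p x | x in `]0, +oo[],
      forall x : R, 0 < x -> p y @[y --> x^'+] --> p x,
      0 < inf (p @` `[1, r]) &
      forall x : R, 0 < x -> p (x * r) = p x].

Definition continuity_points (R : realType) (p : R -> R) : set R :=
  [set x | 0 < x /\ {for x, continuous p}].

Definition Bop (R : realType) (rho : R) (p : R -> R) (x : R) : R :=
  x `^ (- rho) *
  \int[lebesgue_measure]_(y in `]0, x]) (y `^ (rho - 1) * p y).

Definition asymp_equiv (R : realType) (f g : R -> R) : Prop :=
  f x / g x @[x --> +oo] --> (1 : R).

(* The little-o notation needs the filter +oo as a bundled filter. *)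
Definition little_o (R : realType) (f g : R -> R) : Prop :=
  f =o_ (FilterType (pinfty_nbhs R) _) g.

(* Main.v *)
(* Write [F n z = s U(r^n z) / a_n] with [a_n = (r^n)^rho l(r^n)] and a sign [s]
   that makes [s u] ultimately nondecreasing. The [F n] are convex on every
   [[a, oo[] for large [n], and by slow variation they converge to
   [V z = s z^rho p z] on the dense set of continuity points of [p]; convexity
   makes them locally equi-Lipschitz, so they converge everywhere and [V] is
   convex. With [v] the right derivative of [V], set [p0 x = s x^(1-rho) v x].
   Since [V (r x) = r^rho V x], [p0] is log-periodic, and comparing [v x] with
   the slopes of [V] over [[x/r, x]] and [[x, r x]] gives [m p <= p0 <= M p],
   where [m, M > 0] if [rho > 0] and [m = M = 0] if [rho = 0].
   Sandwiching the derivative of [F n] between slopes gives the convergence at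
   the points where [v] is continuous, even along [w_n --> z]; compactness of
   [[1, r]] and the uniform convergence theorem for slowly varying functions
   turn this into the asymptotics on the whole half-line. *)
From HB Require Import structures.
Require Import Defs.
From mathcomp Require Import all_boot all_order all_algebra.
From mathcomp Require Import all_classical all_reals all_analysis.
From mathcomp Require Import measurable_realfun ring lra.
Import Order.TTheory GRing.Theory Num.Theory.
Import numFieldNormedType.Exports.
Local Open Scope classical_set_scope.
Local Open Scope ring_scope.

(** * Translation invariance and the uniform convergence theorem for slowly varying functions *)

Lemma lebesgue_measure_addl {R : realType} (t : R) (A : set R) :
  measurable A ->
  pushforward lebesgue_measure (+%R t : _ -> measurableTypeR R) A =
  lebesgue_measure A.
Proof.
move=> mA.
have maddl : measurable_fun setT (+%R t : measurableTypeR R -> measurableTypeR R).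
  exact: measurable_funD.
have mphi := isMeasurableFun.Build _ _ _ _ _ maddl.
pose phi : {mfun measurableTypeR R >-> measurableTypeR R} := HB.pack (+%R t) mphi.
apply/esym/(@lebesgue_measure_unique _ (pushforward lebesgue_measure phi)) => //.
move=> _ [[a b]] _ <-.
have preE : +%R t @^-1` `]a, b] = `](a - t), (b - t)]%classic.
  by apply/seteqP; split=> x /=; rewrite !in_itv/= ltrBlDl lerBrDl.
transitivity (lebesgue_measure (`](a - t), (b - t)]%classic : set R)).
  rewrite !lebesgue_measure_itv/= !lte_fin ltrD2r -!EFinB.
  by congr (if _ then _%:E else _); ring.
by rewrite -preE.
Qed.

Lemma ge0_integral_addl {R : realType} (t a b : R) (f : R -> \bar R) :
  measurable_fun [set: R] f -> (forall x, 0 <= f x)%E ->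
  (\int[lebesgue_measure]_(x in `[a, b]) f (t + x)%R =
   \int[lebesgue_measure]_(x in `[(t + a)%R, (t + b)%R]) f x)%E.
Proof.
move=> mf f0.
have maddl : measurable_fun setT (+%R t : measurableTypeR R -> measurableTypeR R).
  exact: measurable_funD.
transitivity (\int[pushforward lebesgue_measure
    (+%R t : _ -> measurableTypeR R)]_(x in `[(t + a)%R, (t + b)%R]) f x)%E.
  rewrite ge0_integral_pushforward//=; last exact: measurable_funTS.
  by congr integral; apply/seteqP; split=> x /=; rewrite !in_itv/= !lerD2l.
by apply: eq_measure_integral => A mA _; exact: lebesgue_measure_addl.
Qed.

(* [J x] is small for large
   [x] by dominated convergence, and subadditivity of [phi] bounds
   [phi (h (x + t) - h x)] by [J x + J (x + t)]. *)
Lemma additive_uniform_convergence {R : realType} (h : R -> R) (T : R) :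
  measurable_fun [set: R] h ->
  (forall t : R, h (x + t) - h x @[x --> +oo] --> 0) -> 0 <= T ->
  forall e : R, 0 < e ->
    \forall x \near +oo, forall t, `|t| <= T -> `|h (x + t) - h x| < e.
Proof.
move=> mh hh T0 e e0.
(* Truncation at 1 provides an integrable dominating function, keeps subadditivity, and loses
   nothing for small increments. *)
pose phi (y : R) := Num.min 1 `|y|.
have phi_ge0 y : 0 <= phi y by rewrite /phi le_min ler01 normr_ge0.
have phi_le1 y : phi y <= 1 by rewrite /phi ge_min lexx.
have phi_le y : phi y <= `|y| by rewrite /phi ge_min lexx orbT.
have phiD y z : phi (y - z) <= phi y + phi z.
  rewrite /phi; have := ler_normB y z.
  by rewrite /Num.min; case: ifPn; case: ifPn; case: ifPn;
    have := normr_ge0 y; have := normr_ge0 z; lra.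
have mG x : measurable_fun [set: R] (fun t => (phi (h (x + t) - h x))%:E).
  apply/measurable_EFinP; apply: measurable_minr => //.
  apply: measurableT_comp => //; apply: measurable_funB => //.
  by apply: measurableT_comp => //; exact: measurable_funD.
have G0 x t : (0 <= (phi (h (x + t) - h x))%:E)%E by rewrite lee_fin.
(* This interval contains both [[0, 1]] and its translate by any [t] with [|t| <= T]. *)
pose K : set R := `[- T, T + 1]%classic.
have mK : measurable K by exact: measurable_itv.
have muK : (lebesgue_measure K < +oo)%E.
  by rewrite /K lebesgue_measure_itv/=; case: ifP => _; rewrite ?ltry // -EFinB ltry.
pose J x := (\int[lebesgue_measure]_(t in K)
  (phi (h (x + t)%R - h x)%R)%:E)%E.
have Jfin x : J x \is a fin_num.
  rewrite ge0_fin_numE ?integral_ge0//.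
  apply: (@le_lt_trans _ _ (\int[lebesgue_measure]_(t in K) (cst 1%:E t))%E).
    apply: ge0_le_integral => //; first by apply: measurable_funTS; exact: mG.
    by move=> t _ /=; rewrite lee_fin.
  by rewrite integral_cst// mul1e.
have Jcvg : fine (J x) @[x --> +oo] --> (0 : R).
  apply/cvg_pinftyP => w woo; apply: fine_cvg.
  have [] // := @dominated_convergence _ _ R lebesgue_measure K
    _ (fun n t => (phi (h (w n + t) - h (w n)))%:E) (cst 0%E) (cst 1%E).
  - by move=> n; apply: measurable_funTS; exact: mG.
  - apply: aeW => t _; apply: cvg_EFin; first exact: nearW.
    rewrite /comp/=; apply/norm_cvg0P.
    apply: (@squeeze_cvgr _ _ _ _ (cst 0) (fun n => `|h (w n + t) - h (w n)|)).
    + by apply: nearW => n; rewrite normr_ge0/= ger0_norm.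
    + exact: cvg_cst.
    + by apply/norm_cvg0P; apply: (cvg_comp _ _ woo (hh t)).
  - apply/integrableP; split; first exact: measurable_cst.
    rewrite (eq_integral (cst 1%E)) => [|t _]; last by rewrite /= normr1.
    by rewrite integral_cst// mul1e.
  - by apply: aeW => t n _ /=; rewrite lee_fin ger0_norm.
  - by move=> _ _; rewrite integral_cst// mul0e.
pose d := Num.min 1 e / 2.
have d0 : 0 < d by rewrite divr_gt0// lt_min ltr01.
have /cvgrPdist_lt /(_ _ d0) [M [Mreal HM]] := Jcvg.
(* Beyond [M + T], both [x] and [x + t] exceed [M]. *)
exists (M + T); split; first by rewrite num_real.
move=> x Mx t tT.
have main : ((phi (h (x + t)%R - h x)%R)%:E <= J x + J (x + t)%R)%E.
  pose B s := (phi (h (x + t + s) - h (x + t)))%:E.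
  pose A s := (phi (h (x + (t + s)) - h x))%:E.
  have mA : measurable_fun [set: R] A.
    apply: (@measurableT_comp _ _ _ _ _ _ (fun t => (phi (h (x + t) - h x))%:E)) => //.
    exact: measurable_funD.
  (* A constant is its own mean over [[0, 1]], and for each [s] the increment from [x] to [x + t] is
     a difference of two increments ending at [x + t + s]. *)
  apply: (@le_trans _ _ (\int[lebesgue_measure]_(s in `[0%R, 1%R]) (A s + B s))%E).
    rewrite -[leLHS]mule1.
    have -> : 1%E = lebesgue_measure (`[0%R, 1%R]%classic : set R).
      by rewrite lebesgue_measure_itv/= lte_fin ltr01 sube0.
    rewrite -integral_cst//; apply: ge0_le_integral => //=.
    - by apply: measurable_funTS; apply: emeasurable_funD => //; exact: mG.
    - move=> s _; rewrite lee_fin addrA; apply: le_trans (phiD _ _).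
      by rewrite le_eqVlt; apply/orP; left; apply/eqP; rewrite /phi; congr (Num.min _ `| _ |); ring.
  rewrite ge0_integralD//; last 4 first.
  - by move=> s _; rewrite lee_fin.
  - exact: measurable_funTS.
  - by move=> s _; rewrite lee_fin.
  - by apply: measurable_funTS; exact: mG.
  apply: leeD.
    rewrite (ge0_integral_addl t 0 1 _ (mG x)) ?addr0//.
    apply: ge0_subset_integral => //; first by apply: measurable_funTS; exact: mG.
    move=> s /=; rewrite /K/= !in_itv/= => /andP[s1 s2].
    by move: tT; rewrite ler_norml => /andP[t1 t2]; apply/andP; split; lra.
  apply: ge0_subset_integral => //; first by apply: measurable_funTS; exact: mG.
    by move=> s _; rewrite lee_fin.
  move=> s /=; rewrite /K/= !in_itv/= => /andP[s1 s2].
  by apply/andP; split; lra.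
have Jlt y : M < y -> fine (J y) < d.
  by move=> /HM; rewrite sub0r normrN; exact: le_lt_trans (ler_norm _).
have : phi (h (x + t) - h x) < Num.min 1 e.
  rewrite -lte_fin; apply: le_lt_trans main _.
  rewrite -(fineK (Jfin x)) -(fineK (Jfin (x + t))) -EFinD lte_fin.
  have Mx' : M < x by lra.
  have Mxt : M < x + t by move: tT; rewrite ler_norml => /andP[? _]; lra.
  by have := Jlt _ Mx'; have := Jlt _ Mxt; rewrite /d; lra.
rewrite /phi !lt_min !gt_min ltxx/= => /andP[p1 p2].
by case/orP: p2 => // p2; lra.
Qed.

Lemma cvg_exprn_pinfty {R : realType} (r : R) :
  1 < r -> r ^+ n @[n --> \oo] --> +oo.
Proof.
move=> r1; apply/cvgryPge => M; near=> n.
have bernoulli k : 1 + k%:R * (r - 1) <= r ^+ k.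
  elim: k => [|k IHk]; first by rewrite mul0r addr0 expr0.
  have rk : 1 <= r ^+ k by rewrite exprn_ege1// ltW.
  by rewrite exprS -natr1; nra.
apply: le_trans (bernoulli n); rewrite -lerBlDl -ler_pdivrMr ?subr_gt0//.
by apply/ltW; near: n; exact: nbhs_infty_gtr.
Unshelve. all: end_near. Qed.

(** With [h = ln \o l \o expR], slow variation becomes convergence to 0 of the increments of [h],
    and [[a, b]] becomes a bounded set of shifts [ln lam]. *)
Lemma slowly_varying_uniform {R : realType} (l : R -> R) (a b : R) :
  slowly_varying l -> 0 < a -> forall e : R, 0 < e ->
  \forall x \near +oo, forall lam, a <= lam <= b ->
    `|l (lam * x) / l x - 1| < e.
Proof.
move=> [l0 ml hl] a0 e e0.
pose h (t : R) := ln (l (expR t)).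
have hB x t : h (x + t) - h x = ln (l (expR t * expR x) / l (expR x)).
  by rewrite -expRD [t + x]addrC ln_div// posrE l0// expR_gt0.
have expRy : @expR R x @[x --> +oo] --> +oo.
  apply/cvgryPge => M; near=> x; have : M <= x by near: x; apply: nbhs_pinfty_ge; rewrite num_real.
  by move=> Mx; apply: (le_trans _ (expR_ge1Dx _)); lra.
have mh : measurable_fun [set: R] h.
  apply: measurableT_comp; first exact: measurable_ln.
  have mpos : measurable (`]0, +oo[%classic : set R) by exact: measurable_itv.
  apply: (measurable_comp mpos _ ml) => //.
  by move=> _ [t _ <-]/=; rewrite in_itv/= andbT expR_gt0.
have hcvg t : h (x + t) - h x @[x --> +oo] --> 0.
  have := cvg_comp _ _ (cvg_comp _ _ expRy (hl _ (expR_gt0 t))) (continuous_ln ltr01).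
  by rewrite ln1; under [X in _ -> X]eq_cvg do rewrite hB.
have : \forall y \near (0 : R), `|expR y - 1| < e.
  have := @continuous_expR R 0; rewrite /continuous_at expR0 => /cvgrPdist_lt /(_ e e0).
  by apply: filterS => y; rewrite distrC.
move=> /nbhs_ballP[d /= d0 expd].
pose T := `|ln a| + `|ln b|.
have T0 : 0 <= T by rewrite addr_ge0.
have [M [Mreal HM]] := additive_uniform_convergence _ _ mh hcvg T0 _ d0.
exists (expR M); split; first by rewrite num_real.
move=> x Mx lam /andP[alam lamb].
have lam0 : 0 < lam by exact: lt_le_trans alam.
have x0 : 0 < x by apply: lt_trans Mx; exact: expR_gt0.
have lamT : `|ln lam| <= T.
  have : ln a <= ln lam by rewrite ler_ln ?posrE.
  have : ln lam <= ln b by rewrite ler_ln ?posrE// (lt_le_trans lam0).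
  rewrite /T ler_norml; have := ler_norm (ln b); have := ler_norm (- ln a); rewrite normrN.
  move=> *; apply/andP; split; have := normr_ge0 (ln a); have := normr_ge0 (ln b); lra.
have Mlnx : M < ln x by rewrite -ltr_expR lnK ?posrE.
have := HM _ Mlnx _ lamT; rewrite hB !lnK ?posrE// => lt_d.
have := expd (ln (l (lam * x) / l x)); rewrite lnK ?posrE; last first.
  by rewrite divr_gt0 ?l0 ?mulr_gt0.
by apply; rewrite -ball_normE/= sub0r normrN.
Unshelve. all: end_near. Qed.

(** Uniformity on [[z / 2, 2 * z]], a neighbourhood of [z], allows the factor to move together with
    [n]. *)
Lemma slowly_varying_joint_cvg {R : realType} (l : R -> R) (r z : R) :
  slowly_varying l -> 1 < r -> 0 < z ->
  l (r ^+ wn.2 * wn.1) / l (r ^+ wn.2)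
    @[wn --> filter_prod (nbhs z) \oo] --> (1 : R).
Proof.
move=> hl r1 z0; apply/cvgrPdist_lt => e e0.
have z20 : 0 < z / 2 by rewrite divr_gt0.
have unif : \forall n \near \oo, forall lam, z / 2 <= lam <= 2 * z ->
    `|l (lam * r ^+ n) / l (r ^+ n) - 1| < e.
  exact: (cvg_exprn_pinfty _ r1 _ (slowly_varying_uniform _ _ (2 * z) hl z20 _ e0)).
exists ([set w | z / 2 <= w <= 2 * z], [set n | forall lam, z / 2 <= lam <= 2 * z ->
    `|l (lam * r ^+ n) / l (r ^+ n) - 1| < e]); first split => //=.
  near=> w; apply/andP; split.
    by apply/ltW; near: w; apply: lt_nbhsr; lra.
  by apply/ltW; near: w; apply: lt_nbhsl; lra.
by move=> [w n]/= [wz /(_ _ wz)]; rewrite distrC [_ * w]mulrC.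
Unshelve. all: end_near. Qed.

(** * Density of the continuity points of a right-continuous function *)

Lemma at_right_itv {R : realType} (x : R) (P : set R) :
  (\forall y \near x^'+, P y) ->
  exists2 d : R, 0 < d & forall y, x < y < x + d -> P y.
Proof.
move=> /nbhs_ballP[d /= d0 Pd]; exists d => // y /andP[xy yxd].
apply: Pd => //=; rewrite -ball_normE/= ltr_distlC; apply/andP; split; lra.
Qed.

(* The points of oscillation less than [1/(n+1)] form an open set, dense
   because right continuity makes the oscillation small just to the right of
   any point, and Baire's theorem applies. *)
Lemma right_continuous_dense_continuous {R : realType} (p : R -> R) (a b : R) :
  (forall x, 0 < x -> p y @[y --> x^'+] --> p x) -> 0 < a -> a < b ->
  exists2 y, a < y < b & {for y, continuous p}.
Proof.
move=> rc a0 ab.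
pose smallosc n (c d : R) := forall s t, c < s < d -> c < t < d ->
  `|p s - p t| < n.+1%:R^-1.
(* Baire's theorem is applied on the whole line, while right continuity is given on the positive
   half only; the negative points are therefore put into every [F n]. *)
pose F n : set R := [set y | y < 0 \/ exists c d, c < y < d /\ smallosc n c d].
have openF n : open (F n).
  rewrite openE => y [y0|[c [d [/andP[cy yd] cd]]]].
    by rewrite /interior; near=> w; left; near: w; exact: lt_nbhsl.
  rewrite /interior; near=> w; right; exists c, d; split=> //.
  by apply/andP; split; near: w; [exact: lt_nbhsr|exact: lt_nbhsl].
have denseF n : dense (F n).
  move=> D [y0 Dy0] Dopen; have [y00|y00] := ltP y0 0; first by exists y0; split=> //; left.
  have right_in z : D z -> \forall y \near z^'+, D y.
    by move=> Dz; apply: cvg_at_right_filter; [exact: cvg_id|exact: open_nbhs_nbhs].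
  have [d1 d10 Dd1] := at_right_itv _ _ (right_in _ Dy0).
  (* The point [y0] may be 0, where right continuity is not given, so it is first moved to the right
     inside [D]. *)
  have [y1 [Dy1 y10]] : exists y1, D y1 /\ 0 < y1.
    by exists (y0 + d1 / 2); split; [apply: Dd1; apply/andP; split|]; lra.
  have [d2 d20 Dd2] := at_right_itv _ _ (right_in _ Dy1).
  have e0 : 0 < n.+1%:R^-1 / 2 :> R by rewrite divr_gt0// invr_gt0.
  have /cvgrPdist_lt /(_ _ e0) /at_right_itv[d3 d30 pd3] := rc _ y10.
  have [d [d0 dd2 dd3]] : exists d : R, [/\ 0 < d, d <= d2 & d <= d3].
    by exists (Num.min d2 d3); rewrite lt_min d20 !ge_min !lexx orbT.
  exists (y1 + d / 2); split; first by apply: Dd2; apply/andP; split; lra.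
  right; exists y1, (y1 + d); split; first by apply/andP; split; lra.
  move=> s t /andP[s1 s2] /andP[t1 t2].
  have ps : `|p y1 - p s| < n.+1%:R^-1 / 2 by apply: pd3; apply/andP; split; lra.
  have pt : `|p y1 - p t| < n.+1%:R^-1 / 2 by apply: pd3; apply/andP; split; lra.
  move: ps pt; move: (n.+1%:R^-1) => q.
  by rewrite !ltr_norml => /andP[? ?] /andP[? ?]; apply/andP; split; lra.
have /(_ `]a, b[%classic) := @Baire R R F (fun n => conj (openF n) (denseF n)).
case.
- by exists ((a + b) / 2); rewrite /= in_itv/=; apply/andP; split; lra.
- exact: interval_open.
move=> y [/=]; rewrite in_itv/= => /andP[ay yb] Fy.
exists y; first exact/andP.
apply/cvgrPdist_lt => e e0.
have [n ne] : exists n : nat, n.+1%:R^-1 < e.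
  have [n _ ne] := near_infty_natSinv_lt (PosNum e0).
  by exists n; exact: (ne n (leqnn n)).
have [|[c [d [/andP[cy yd] cd]]]] := Fy n I; first by lra.
near=> w; apply: lt_trans ne; apply: cd; apply/andP; split=> //; near: w.
  exact: lt_nbhsr.
exact: lt_nbhsl.
Unshelve. all: end_near. Qed.

(** * Chord slopes and right derivatives of convex functions *)

Definition slope {R : realType} (V : R -> R) (a b : R) := (V b - V a) / (b - a).

(** Convexity on the positive half-line, in a form that involves only finitely many values of [V]
    and so passes to pointwise limits. *)
Definition slopes_nondecreasing {R : realType} (V : R -> R) :=
  forall a b c d, 0 < a -> a < b -> b <= c -> c < d -> slope V a b <= slope V c d.

(* The right derivative of a convex function [V], as an infimum over intervals
   strictly to the right of [x], which makes it obviously right-continuous. *)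
Definition rslope {R : realType} (V : R -> R) (x : R) :=
  inf [set s | exists y z, [/\ x < y, y < z & s = slope V y z]].

Lemma rslope_le {R : realType} (V : R -> R) (x y z : R) :
  slopes_nondecreasing V -> 0 < x -> x < y -> y < z -> rslope V x <= slope V y z.
Proof.
move=> cV x0 xy yz; apply: ge_inf; last by exists y, z.
(* A chord to the left of [x] bounds the set from below; without a lower bound [inf] would be a
   default value. *)
exists (slope V (x / 2) x) => _ [y' [z' [xy' yz' ->]]].
by apply: cV => //; lra.
Qed.

Lemma le_rslope {R : realType} (V : R -> R) (x c : R) :
  (forall y z, x < y -> y < z -> c <= slope V y z) -> c <= rslope V x.
Proof.
move=> cS; apply: lb_le_inf; last by move=> _ [y [z [xy yz ->]]]; exact: cS.
by exists (slope V (x + 1) (x + 2)), (x + 1), (x + 2); split => //; lra.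
Qed.

Lemma slope_le_rslope {R : realType} (V : R -> R) (a b x : R) :
  slopes_nondecreasing V -> 0 < a -> a < b -> b <= x -> slope V a b <= rslope V x.
Proof.
by move=> cV a0 ab bx; apply: le_rslope => y z xy yz; apply: cV => //; lra.
Qed.

Lemma rslope_nondecreasing {R : realType} (V : R -> R) (x y : R) :
  slopes_nondecreasing V -> 0 < x -> x <= y -> rslope V x <= rslope V y.
Proof.
move=> cV x0 xy; apply: le_rslope => a b ya ab.
by apply: rslope_le => //; lra.
Qed.

Lemma rslope_lt {R : realType} (V : R -> R) (x e : R) : 0 < e ->
  exists y z, [/\ x < y, y < z & slope V y z < rslope V x + e].
Proof.
move=> e0; apply: contrapT => H.
suff : rslope V x + e <= rslope V x by lra.
apply: le_rslope => y z xy yz; rewrite leNgt; apply/negP => lt_e.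
by apply: H; exists y, z.
Qed.

Lemma rslope_right_continuous {R : realType} (V : R -> R) (x : R) :
  slopes_nondecreasing V -> 0 < x -> rslope V y @[y --> x^'+] --> rslope V x.
Proof.
move=> cV x0; apply/cvgrPdist_lt => e e0.
have [y [z [xy yz Sxe]]] := rslope_lt V x _ e0.
near=> w.
have xw : x < w by near: w; exact: nbhs_right_gt.
have wy : w < y by near: w; exact: nbhs_right_lt.
have := rslope_nondecreasing _ _ _ cV x0 (ltW xw).
have := rslope_le V w y z cV (lt_trans x0 xw) wy yz.
by rewrite ltr_norml => ? ?; apply/andP; split; lra.
Unshelve. all: end_near. Qed.

(** The infimum sees only chords strictly to the right of [x]; right continuity of [V] lets their
    left endpoint descend to [x]. *)
Lemma rslope_le_slope {R : realType} (V : R -> R) (x y : R) :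
  slopes_nondecreasing V -> V w @[w --> x^'+] --> V x ->
  0 < x -> x < y -> rslope V x <= slope V x y.
Proof.
move=> cV rV x0 xy.
have cS : slope V w y @[w --> x^'+] --> slope V x y.
  apply: cvgM; first by apply: cvgB => //; exact: cvg_cst.
  apply: cvgV; first by rewrite subr_eq0 gt_eqF.
  by apply: cvgB; [exact: cvg_cst|exact: cvg_at_right_filter cvg_id].
apply: (cvgr_to_ge cS); near=> w; apply: rslope_le => //.
Unshelve. all: end_near. Qed.

(** * Limits of convex functions and of their derivatives *)

Lemma cvg_slope {R : realType} (F : nat -> R -> R) (V : R -> R) (a b : R) :
  F n a @[n --> \oo] --> V a -> F n b @[n --> \oo] --> V b ->
  slope (F n) a b @[n --> \oo] --> slope V a b.
Proof. by move=> Fa Fb; apply: cvgM; [exact: cvgB|exact: cvg_cst]. Qed.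

(* [g n] plays the role of the derivative of the convex function [F n]. *)
Definition eventually_slopes {R : realType} (F g : nat -> R -> R) :=
  forall a : R, 0 < a -> \forall n \near \oo, forall x y, a <= x -> x < y ->
    g n x <= slope (F n) x y <= g n y.

Lemma eventually_slopes_chain {R : realType} (F g : nat -> R -> R) (e : R) :
  eventually_slopes F g -> 0 < e -> \forall n \near \oo,
    (forall x y, e <= x -> x < y -> g n x <= slope (F n) x y <= g n y) /\
    (forall x y, e <= x -> x <= y -> g n x <= g n y).
Proof.
move=> Fg e0; have := Fg e e0; apply: filterS => n H; split=> // x y ex.
rewrite le_eqVlt => /predU1P[->//|xy].
by have /andP[] := H x y ex xy; exact: le_trans.
Qed.

(** Chords between points of convergence on either side of [x] make the [F n] equi-Lipschitz near
    [x]. The value at [x] is then compared with that at a point of convergence [y] slightly to the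
    right, the side on which [V] is continuous. *)
Lemma convex_cvg {R : realType} (F g : nat -> R -> R) (V : R -> R) :
  eventually_slopes F g ->
  (forall x, 0 < x -> V y @[y --> x^'+] --> V x) ->
  (forall a b, 0 < a -> a < b ->
    exists2 y, a < y < b & F n y @[n --> \oo] --> V y) ->
  forall x, 0 < x -> F n x @[n --> \oo] --> V x.
Proof.
move=> Fg rV dense x x0; apply/cvgrPdist_lt => e e0.
have [||e1 /andP[e11 e12] Fe1] := dense (x / 4) (x / 2); [lra|lra|].
have [||e2 /andP[e21 e22] Fe2] := dense (x / 2) x; [lra|lra|].
have [||d1 /andP[d11 d12] Fd1] := dense (x + 1) (x + 2); [lra|lra|].
have [||d2 /andP[d21 d22] Fd2] := dense (x + 2) (x + 3); [lra|lra|].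
have lt_e : e1 < e2 by exact: lt_trans e12 e21.
have lt_d : d1 < d2 by exact: lt_trans d12 d21.
have e10 : 0 < e1 by apply: lt_trans e11; rewrite divr_gt0.
have e1x : e1 <= x by rewrite ltW// (lt_trans lt_e).
have x1d1 : x + 1 <= d1 by exact: ltW.
(* The chord slopes of [F n] over [[e1, e2]] and [[d1, d2]] are eventually within 1 of those of [V],
   so [L] bounds the slope over [[x, y]]. *)
pose L := `|slope V e1 e2| + `|slope V d1 d2| + 1.
have L0 : 0 < L by rewrite ltr_wpDl// addr_ge0.
have eL0 : 0 < e / 3 / L by rewrite !divr_gt0.
have e30 : 0 < e / 3 by rewrite divr_gt0.
have /cvgrPdist_lt /(_ _ e30) /at_right_itv[d d0 Vd] := rV x x0.
(* The three upper bounds keep [y] to the left of [d1], [V y] close to [V x], and [L * (y - x)]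
   below [e / 3]. *)
have [d' [d'0 d'1 d'd d'e]] : exists d' : R, [/\ 0 < d', d' <= 1, d' <= d & d' <= e / 3 / L].
  exists (Num.min 1 (Num.min d (e / 3 / L))).
  by rewrite !lt_min ltr01 d0 eL0 !ge_min !lexx !orbT.
have [|y /andP[xy yd] Fy] := dense x (x + d') x0; first by lra.
have yd1 : y <= d1.
  by apply: le_trans x1d1; rewrite (le_trans (ltW yd))// lerD2l.
have yx0 : 0 < y - x by rewrite subr_gt0.
have Vxy : `|V x - V y| < e / 3 by apply: Vd; apply/andP; split; lra.
have Lyx : L * (y - x) < e / 3.
  have : y - x < e / 3 / L by lra.
  by rewrite ltr_pdivlMr// mulrC.
near=> n.
have [Sg gmono] : (forall x y, e1 <= x -> x < y -> g n x <= slope (F n) x y <= g n y) /\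
    (forall x y, e1 <= x -> x <= y -> g n x <= g n y).
  by near: n; exact: eventually_slopes_chain.
have Fny : `|V y - F n y| < e / 3 by near: n; move/cvgrPdist_lt: Fy; exact.
have Sn1 : `|slope V e1 e2 - slope (F n) e1 e2| < 1.
  by near: n; have /cvgrPdist_lt := cvg_slope _ _ _ _ Fe1 Fe2; exact.
have Sn2 : `|slope V d1 d2 - slope (F n) d1 d2| < 1.
  by near: n; have /cvgrPdist_lt := cvg_slope _ _ _ _ Fd1 Fd2; exact.
have Sxy : `|slope (F n) x y| <= L.
  have /andP[_ g1] := Sg e1 e2 (lexx _) lt_e.
  have /andP[g2 _] := Sg d1 d2 (le_trans e1x (le_trans (ltW xy) yd1)) lt_d.
  have /andP[g3 g4] := Sg x y e1x xy.
  have g5 := gmono e2 x (ltW lt_e) (ltW e22).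
  have g6 := gmono y d1 (le_trans e1x (ltW xy)) yd1.
  have lo : slope (F n) e1 e2 <= slope (F n) x y by apply: le_trans g3; exact: le_trans g5.
  have up : slope (F n) x y <= slope (F n) d1 d2 by apply: le_trans g2; exact: le_trans g6.
  move: Sn1 Sn2 lo up; rewrite /L; clear.
  move: (slope V _ _) (slope V _ _) (slope (F n) e1 e2) (slope (F n) x y) (slope (F n) d1 d2).
  move=> s2 s1 t1 t t2; rewrite !ltr_norml => /andP[? ?] /andP[? ?] ? ?.
  have := ler_norm s2; have := ler_norm (- s1); have := normr_ge0 s1; have := normr_ge0 s2.
  by rewrite normrN ler_norml => ? ? ? ?; apply/andP; split; lra.
have Fxy : `|F n y - F n x| < e / 3.
  apply: le_lt_trans (Lyx).
  have -> : F n y - F n x = slope (F n) x y * (y - x).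
    by rewrite /slope mulfVK// gt_eqF.
  by rewrite normrM (gtr0_norm yx0) ler_pM2r.
have -> : V x - F n x = (V x - V y) + (V y - F n y) + (F n y - F n x) by ring.
apply: (le_lt_trans (ler_normD _ _)).
have := ler_normD (V x - V y) (V y - F n y).
move: Vxy Fny Fxy; move: (_ - _) (_ - _) (_ - _) => ? ? ?; clear.
by move=> ? ? ? ?; lra.
Unshelve. all: end_near. Qed.

(** Values of [g n] separate the chord slopes of [F n], and weak inequalities survive the limit. *)
Lemma convex_limit {R : realType} (F g : nat -> R -> R) (V : R -> R) :
  eventually_slopes F g ->
  (forall x, 0 < x -> F n x @[n --> \oo] --> V x) -> slopes_nondecreasing V.
Proof.
move=> Fg FV a b c d a0 ab bc cd.
have Sab := cvg_slope _ _ _ _ (FV a a0) (FV b ltac:(lra)).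
have Scd := cvg_slope _ _ _ _ (FV c ltac:(lra)) (FV d ltac:(lra)).
apply: (ler_cvg_to Sab Scd); have := eventually_slopes_chain F g a Fg a0.
apply: filterS => n [Sg gmono].
have /andP[_ Sb] := Sg a b (lexx _) ab.
have /andP[Sc _] := Sg c d ltac:(lra) cd.
by apply: (le_trans Sb); apply: le_trans Sc; apply: gmono => //; lra.
Qed.

(** For all [w] near [z], monotonicity traps [g n w] between the chord slopes of [F n] over two
    fixed intervals, one on each side of [z]. These slopes converge to those of [V], which are
    chosen within [e / 2] of [rslope V z]. *)
Lemma derivative_joint_cvg {R : realType} (F g : nat -> R -> R) (V : R -> R) (z : R) :
  eventually_slopes F g ->
  (forall x, 0 < x -> F n x @[n --> \oo] --> V x) ->
  0 < z -> {for z, continuous (rslope V)} ->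
  g wn.2 wn.1 @[wn --> filter_prod (nbhs z) \oo] --> rslope V z.
Proof.
move=> Fg FV z0 cz; have cV := convex_limit _ _ _ Fg FV.
apply/cvgrPdist_lt => e e0.
have e20 : 0 < e / 2 by lra.
have [y [y' [zy yy' Sy]]] := rslope_lt V z _ e20.
have [a [b [a0 ab bz Sa]]] : exists a b,
    [/\ 0 < a, a < b, b < z & rslope V z - e / 2 < slope V a b].
  have /cvgrPdist_lt /(_ _ e20) /nbhs_ballP[d /= d0 Hd] := cz.
  pose m := Num.min d z.
  have [m0 md mz] : [/\ 0 < m, m <= d & m <= z].
    by rewrite lt_min d0 z0 !ge_min !lexx orbT.
  (* This chord lies to the right of [z - m * (3 / 4)], where [rslope V] is already close to its
     value at [z] and from where it bounds the chord slope from below; [m <= z] keeps all points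
     positive. *)
  exists (z - m / 2), (z - m / 4); split; [lra|lra|lra|].
  have := Hd (z - m * (3 / 4)); rewrite -ball_normE/= => /(_ _).
  have -> : z - (z - m * (3 / 4)) = m * (3 / 4) by ring.
  rewrite gtr0_norm ?mulr_gt0// ltr_norml => /(_ ltac:(lra)) /andP[_ lt_e].
  have := rslope_le V (z - m * (3 / 4)) (z - m / 2) (z - m / 4) cV ltac:(lra) ltac:(lra) ltac:(lra).
  by lra.
have Say := cvg_slope _ _ _ _ (FV a a0) (FV b ltac:(lra)).
have Syy := cvg_slope _ _ _ _ (FV y ltac:(lra)) (FV y' ltac:(lra)).
have nN : \forall n \near \oo, forall w, b < w < y -> `|rslope V z - g n w| < e.
  near=> n.
  have [Sg gmono] : (forall x y, a <= x -> x < y -> g n x <= slope (F n) x y <= g n y) /\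
      (forall x y, a <= x -> x <= y -> g n x <= g n y).
    by near: n; exact: eventually_slopes_chain.
  have Sna : `|slope V a b - slope (F n) a b| < e / 2.
    by near: n; move/cvgrPdist_lt: Say; exact.
  have Sny : `|slope V y y' - slope (F n) y y'| < e / 2.
    by near: n; move/cvgrPdist_lt: Syy; exact.
  move=> w /andP[bw wy].
  have /andP[_ g1] := Sg a b (lexx _) ab.
  have /andP[g2 _] := Sg y y' ltac:(lra) yy'.
  have g3 := gmono b w ltac:(lra) ltac:(lra).
  have g4 := gmono w y ltac:(lra) ltac:(lra).
  move: Sna Sny; rewrite !ltr_norml => /andP[? ?] /andP[? ?].
  by apply/andP; split; lra.
exists ([set w | b < w < y], [set n | forall w, b < w < y -> `|rslope V z - g n w| < e]).
  split=> //=; near=> w; apply/andP; split; near: w.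
    exact: lt_nbhsr.
  exact: lt_nbhsl.
by move=> [w n]/= [wby]; exact.
Unshelve. all: end_near. Qed.

(** * Integrals of monotone functions as increments of a primitive *)

Lemma Rintegral_itv_bounds {R : realType} (f : R -> R) (x y c d : R) :
  lebesgue_measure.-integrable `]x, y]%classic (EFin \o f) -> x < y ->
  (forall t, x < t -> t <= y -> c <= f t <= d) ->
  c * (y - x) <= \int[lebesgue_measure]_(t in `]x, y]) f t <= d * (y - x).
Proof.
move=> fi xy cfd.
have mxy : measurable (`]x, y]%classic : set R) by exact: measurable_itv.
have muxy : lebesgue_measure (`]x, y]%classic : set R) = (y - x)%:E.
  by rewrite lebesgue_measure_itv/= lte_fin xy.
have cst_i k : lebesgue_measure.-integrable (`]x, y]%classic : set R) (EFin \o cst k).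
  apply: measurable_bounded_integrable => //; first by move: (ltry (y - x)); rewrite -muxy.
  by exists `|k|; split; [exact: num_real|move=> M kM t _; exact: ltW].
have cst_int k : k * (y - x) = \int[lebesgue_measure]_(t in `]x, y]) cst k t.
  have -> : y - x = fine (y - x)%:E by [].
  by rewrite -muxy Rintegral_cst.
rewrite !cst_int; apply/andP; split; apply: le_Rintegral => // t;
  rewrite /= in_itv/= => /andP[xt ty]; by have /andP[] := cfd t xt ty.
Qed.

Lemma nondecreasing_itv_integrable {R : realType} (v : R -> R) (a b : R) :
  (forall x y, a <= x -> x <= y -> y <= b -> v x <= v y) -> a <= b ->
  lebesgue_measure.-integrable `]a, b]%classic (EFin \o v).
Proof.
move=> v_nd ab.
have muab : (lebesgue_measure (`]a, b]%classic : set R) < +oo)%E.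
  by rewrite lebesgue_measure_itv/= lte_fin; case: ifP => _; rewrite ?ltry// -EFinB ltry.
apply: measurable_bounded_integrable.
- exact: measurable_itv.
- exact: muab.
(* Clamping the argument to [[a, b]] extends [v] to a function monotone on the whole line, hence
   measurable. *)
- pose w x := v (Num.max a (Num.min b x)).
  apply: (@eq_measurable_fun _ _ _ _ _ w).
    move=> x; rewrite inE/= in_itv/= => /andP[ax xb].
    by rewrite /w min_r// max_r// ltW.
  apply: nondecreasing_measurable; first exact: measurable_itv.
  move=> x y xy; apply: v_nd; first by rewrite le_max lexx.
    by rewrite le_max2// le_min2.
  by rewrite ge_max ab ge_min lexx.
- exists (`|v a| + `|v b|); split; first exact: num_real.
  move=> M vM x /=; rewrite in_itv/= => /andP[ax xb]; apply: le_trans (ltW vM).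
  have := v_nd a x (lexx _) (ltW ax) xb; have := v_nd x b (ltW ax) xb (lexx _).
  have := ler_norm (v b); have := ler_norm (- v a).
  have := normr_ge0 (v a); have := normr_ge0 (v b).
  rewrite normrN => *; rewrite ler_norml; apply/andP; split; lra.
Qed.

(* Fundamental theorem of calculus without differentiability: [V b - V a] and
   the integral lie both between the lower and the upper sum of any partition,
   and for the dyadic ones these differ by [(b - a) (v b - v a) / 2^n]. *)
Lemma integral_nondecreasing_slope {R : realType} (v V : R -> R) (a b : R) :
  (forall x y, a <= x -> x <= y -> y <= b -> v x <= v y) ->
  (forall x y, a <= x -> x < y -> y <= b -> v x <= slope V x y <= v y) ->
  a < b -> \int[lebesgue_measure]_(t in `]a, b]) v t = V b - V a.
Proof.
move=> v_nd vV ab.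
have vi x y : a <= x -> x <= y -> y <= b ->
    lebesgue_measure.-integrable `]x, y]%classic (EFin \o v).
  move=> ax xy yb; apply: nondecreasing_itv_integrable => // s t xs st ty.
  by apply: v_nd => //; [exact: le_trans xs|exact: le_trans yb].
pose I x y := \int[lebesgue_measure]_(t in `]x, y]) v t.
have dyadic n : forall x y, a <= x -> x < y -> y <= b ->
    `|I x y - (V y - V x)| <= (y - x) * (v y - v x) * 2^-1 ^+ n.
  elim: n => [|n IHn] x y ax xy yb.
    have yx0 : 0 < y - x by rewrite subr_gt0.
    have /andP[I1 I2] : v x * (y - x) <= I x y <= v y * (y - x).
      apply: Rintegral_itv_bounds => //; first by apply: vi => //; exact: ltW.
      move=> t xt ty; rewrite !v_nd//; [exact: le_trans ax (ltW xt)|exact: ltW|].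
      exact: le_trans yb.
    have /andP := vV x y ax xy yb; rewrite /slope ler_pdivlMr// ler_pdivrMr// => -[V1 V2].
    by rewrite expr0 mulr1 ler_norml; apply/andP; split; lra.
  pose m := (x + y) / 2.
  have [xm my] : x < m /\ m < y by rewrite /m; split; lra.
  have IxyE : I x y = I x m + I m y.
    have := @Rintegral_itvB _ v (BRight x) (BRight y) m; rewrite /I => <-.
    - by rewrite addrC subrK.
    - by apply: vi => //; exact: ltW.
    - by rewrite bnd_simp ltW.
    - by rewrite bnd_simp ltW.
  have h1 := IHn x m ax xm (le_trans (ltW my) yb).
  have h2 := IHn m y (le_trans ax (ltW xm)) my yb.
  have -> : I x y - (V y - V x) = (I x m - (V m - V x)) + (I m y - (V y - V m)).
    by rewrite IxyE; ring.
  apply: (le_trans (ler_normD _ _)); apply: (le_trans (lerD h1 h2)).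
  (* Both halves have length [(y - x) / 2] and the increments of [v] telescope, so the bound is
     exactly halved. *)
  by rewrite exprS /m le_eqVlt; apply/orP; left; apply/eqP; field.
apply/eqP; rewrite -subr_eq0 -normr_le0.
have := @cvg_geometric R ((b - a) * (v b - v a)) 2^-1.
rewrite gtr0_norm// invf_lt1// => /(_ ltac:(lra)) /cvgr_to_ge; apply.
by apply: nearW => n; exact: dyadic.
Qed.

(** This makes [s * U] convex on [[x0, +oo[], with [s * u] in the role of its derivative; for
    [s = -1] the two bounds on the integral trade places. *)
Lemma integral_slope {R : realType} (u U : R -> R) (x0 s : R) :
  0 <= x0 ->
  (forall x, 0 <= x -> 0 <= u x) ->
  measurable_fun (`[0, +oo[ : set R) u ->
  (forall x, 0 <= x -> (\int[lebesgue_measure]_(y in `[0%R, x]) (u y)%:E < +oo)%E) ->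
  (forall x, 0 <= x -> U x = \int[lebesgue_measure]_(y in `[0, x]) u y) ->
  (forall x y, x0 <= x -> x <= y -> s * u x <= s * u y) ->
  s = 1 \/ s = -1 ->
  forall x y, x0 <= x -> x < y ->
    s * u x * (y - x) <= s * (U y - U x) <= s * u y * (y - x).
Proof.
move=> x00 u0 mu Ufin UE u_nd s1 x y x0x xy.
have x_ge0 : 0 <= x by exact: le_trans x0x.
have ui : lebesgue_measure.-integrable `[0, y]%classic (EFin \o u).
  apply/integrableP; split.
    apply/measurable_EFinP; apply: measurable_funS mu => //.
    by move=> t /=; rewrite !in_itv/= => /andP[-> _].
  rewrite (le_lt_trans _ (Ufin y (le_trans x_ge0 (ltW xy))))// le_eqVlt; apply/orP; left; apply/eqP.
  apply: eq_integral => t; rewrite inE/= in_itv/= => /andP[t0 _].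
  by rewrite ger0_norm// u0.
have uixy : lebesgue_measure.-integrable `]x, y]%classic (EFin \o u).
  apply: integrableS ui => // t /=; rewrite !in_itv/= => /andP[xt ->].
  by rewrite andbT ltW// (le_lt_trans x_ge0).
have UyxE : U y - U x = \int[lebesgue_measure]_(t in `]x, y]) u t.
  rewrite !UE//; last by rewrite (le_trans x_ge0)// ltW.
  rewrite -(@Rintegral_itvB _ u (BLeft 0) (BRight y) x)//.
  by rewrite bnd_simp ltW.
case: s1 u_nd => -> u_nd.
  rewrite !mul1r UyxE; apply: Rintegral_itv_bounds => // t xt ty.
  have := u_nd x t x0x (ltW xt); have := u_nd t y (le_trans x0x (ltW xt)) ty.
  by rewrite !mul1r => -> ->.
rewrite !mulN1r !mulNr !lerN2 UyxE andbC; apply: Rintegral_itv_bounds => // t xt ty.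
have := u_nd x t x0x (ltW xt); have := u_nd t y (le_trans x0x (ltW xt)) ty.
by rewrite !mulN1r !lerN2 => -> ->.
Qed.

(** Since [w] may be unbounded near 0, []0, x]] is exhausted by the intervals []a n, x]] and
    monotone convergence applies. *)
Lemma integral_itv0_limit {R : realType} (w W : R -> R) (x : R) (a : nat -> R) :
  (forall t, 0 < t -> 0 <= w t) ->
  (forall n, 0 < a n < x) -> (forall n, a n.+1 <= a n) ->
  a n @[n --> \oo] --> 0 -> W (a n) @[n --> \oo] --> 0 ->
  (forall n, lebesgue_measure.-integrable `]a n, x]%classic (EFin \o w)) ->
  (forall n, \int[lebesgue_measure]_(t in `]a n, x]) w t = W x - W (a n)) ->
  \int[lebesgue_measure]_(t in `]0, x]) w t = W x.
Proof.
move=> w0 ax a_ni a0 Wa0 wi wE.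
pose F n : set R := `]a n, x]%classic.
have a_gt0 n : 0 < a n by case/andP: (ax n).
have a_anti : {homo a : m n / (m <= n)%N >-> n <= m}.
  by apply/nonincreasing_seqP.
have UF : \bigcup_n F n = `]0, x]%classic.
  apply/seteqP; split=> t /=.
    by move=> [n _]; rewrite /F/= !in_itv/= => /andP[/(lt_trans (a_gt0 n))-> ->].
  rewrite in_itv/= => /andP[t0 tx].
  have [n _ an] : \forall n \near \oo, a n < t by apply: cvgr_lt a0 _ _.
  by exists n => //; rewrite /F/= in_itv/= tx andbT; apply: an => /=.
have : (\int[lebesgue_measure]_(t in F n) (w t)%:E @[n --> \oo] -->
        \int[lebesgue_measure]_(t in \bigcup_n F n) (w t)%:E)%E.
  apply: ge0_nondecreasing_set_cvg_integral.
  - apply/nondecreasing_seqP => n; apply/subsetPset => t /=.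
    by rewrite /F/= !in_itv/= => /andP[/(le_lt_trans (a_ni n))-> ->].
  - by move=> n; exact: measurable_itv.
  - by move=> n; exact: measurable_int (wi n).
  - move=> n t; rewrite /F/= in_itv/= => /andP[ant _].
    by rewrite lee_fin w0// (lt_trans (a_gt0 n)).
have FE n : (\int[lebesgue_measure]_(t in F n) (w t)%:E)%E = (W x - W (a n))%:E.
  by rewrite -wE /Rintegral fineK//; apply: integrable_fin_num (wi n); exact: measurable_itv.
under eq_cvg do rewrite FE.
rewrite UF => cvgF.
have cvgW : (W x - W (a n))%:E @[n --> \oo] --> (W x)%:E.
  apply: cvg_EFin; first exact: nearW.
  by rewrite -[X in _ --> X]subr0; apply: cvgB => //; exact: cvg_cst.
by rewrite /Rintegral (cvg_unique _ cvgF cvgW).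
Qed.

(** * Log-periodicity and scaling by powers of [r] *)

Lemma exists_exprn_itv {R : realType} (r x : R) : 1 < r -> 1 <= x ->
  exists n, r ^+ n <= x < r ^+ n.+1.
Proof.
move=> r1 x1.
have /ex_minnP[[|n] xn n_min] : exists n, x < r ^+ n.
  have /cvgryPgt /(_ x) [N _ HN] := cvg_exprn_pinfty r r1.
  by exists N; apply: HN => /=.
  by move: xn; rewrite expr0 ltNge x1.
by exists n; rewrite xn andbT leNgt; apply/negP => /n_min; rewrite ltnn.
Qed.

Lemma periodic_exprn {R : realType} (r : R) (p : R -> R) (n : nat) (x : R) :
  0 < r -> (forall y, 0 < y -> p (y * r) = p y) -> 0 < x -> p (r ^+ n * x) = p x.
Proof.
move=> r0 pr x0; elim: n => [|n IHn]; first by rewrite mul1r.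
by rewrite exprSr mulrAC pr// mulr_gt0// exprn_gt0.
Qed.

Lemma powR_continuous {R : realType} (e z : R) :
  0 < z -> {for z, continuous (fun x : R => x `^ e)}.
Proof.
move=> z0; apply: differentiable_continuous; apply/derivable1_diffP.
by apply: derivable_powR; rewrite in_itv/= andbT.
Qed.

(* Compactness of [1, r] upgrades the continuous convergence of [Q (r ^+ n * w)]
   to convergence along the whole half-line. *)
Lemma joint_cvg_pinfty {R : realType} (r : R) (Q p : R -> R) :
  1 < r -> (forall y, 0 < y -> p (y * r) = p y) ->
  (forall z : R, 0 < z -> {for z, continuous p}) ->
  (forall z : R, 0 < z ->
    Q (r ^+ wn.2 * wn.1) @[wn --> filter_prod (nbhs z) \oo] --> p z) ->
  Q x - p x @[x --> +oo] --> 0.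
Proof.
move=> r1 pr pc Qp; have r0 : 0 < r by exact: lt_trans r1.
apply/cvgrPdist_lt => e e0.
have /compact_near_coveringP cover := @segment_compact R 1 r.
have [|N _ HN] := cover nat \oo (fun n w => `|0 - (Q (r ^+ n * w) - p w)| < e) _.
  move=> z /=; rewrite in_itv/= => /andP[z1 _].
  have z0 : 0 < z by exact: lt_le_trans z1.
  have : Q (r ^+ wn.2 * wn.1) - p wn.1 @[wn --> filter_prod (nbhs z) \oo] --> p z - p z.
    by apply: cvgB; [exact: Qp|apply: (cvg_comp fst p _ (pc z z0)); exact: cvg_fst].
  by rewrite subrr => /cvgrPdist_lt /(_ _ e0).
exists (r ^+ N); split; first exact: num_real.
move=> x rNx.
have rn0 n : 0 < r ^+ n by exact: exprn_gt0.
(* Dividing by [r ^+ N] first makes the total exponent [k + N] at least [N], while the reduced point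
   [x / r ^+ (k + N)] lies in [[1, r]]. *)
have [k /andP[kx xk]] : exists k, r ^+ k <= x / r ^+ N < r ^+ k.+1.
  by apply: exists_exprn_itv => //; rewrite ler_pdivlMr// mul1r ltW.
rewrite ler_pdivlMr// -exprD in kx; rewrite ltr_pdivrMr// -exprD addSn exprSr in xk.
have xE : x = r ^+ (k + N) * (x / r ^+ (k + N)) by rewrite mulrC divfK// gt_eqF.
have x0 : 0 < x / r ^+ (k + N) by rewrite divr_gt0// (lt_trans (rn0 N)).
rewrite [in Q x]xE [in p x]xE (periodic_exprn _ p)//.
have := HN (k + N)%N (leq_addl _ _) (x / r ^+ (k + N)); rewrite /=; apply.
rewrite in_itv/= ler_pdivlMr// mul1r kx/= ler_pdivrMr// mulrC ltW//.
Qed.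

(** Dilation by [r] maps the chords to the right of [x] onto those to the right of [r * x] and
    multiplies their slopes by [k / r]. *)
Lemma rslope_scale {R : realType} (V : R -> R) (r k x : R) :
  slopes_nondecreasing V -> 0 < r -> 0 < k ->
  (forall y, 0 < y -> V (r * y) = k * V y) ->
  0 < x -> rslope V (r * x) = k / r * rslope V x.
Proof.
move=> cV r0 k0 Vr x0.
have slope_r y z : 0 < y -> y < z -> slope V (r * y) (r * z) = k / r * slope V y z.
  move=> y0 yz; rewrite /slope !Vr//; last exact: lt_trans yz.
  have zy : z - y != 0 by rewrite subr_eq0 gt_eqF.
  have rzy : r * z - r * y != 0 by rewrite -mulrBr mulf_neq0// gt_eqF.
  by field; rewrite rzy zy gt_eqF.
have kr0 : 0 < k / r by rewrite divr_gt0.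
apply/eqP; rewrite eq_le; apply/andP; split.
  rewrite -ler_pdivrMl//; apply: le_rslope => y z xy yz.
  rewrite ler_pdivrMl// -slope_r//; last exact: lt_trans xy.
  by apply: rslope_le => //; rewrite ?mulr_gt0// ltr_pM2l.
apply: le_rslope => y z xy yz.
have xy' : x < y / r by rewrite ltr_pdivlMr// mulrC.
have yz' : y / r < z / r by rewrite ltr_pM2r// invr_gt0.
rewrite -[y](mulfVK (lt0r_neq0 r0)) -[z](mulfVK (lt0r_neq0 r0)) ![_ / r * r]mulrC.
rewrite slope_r//; last exact: lt_trans xy'.
by rewrite ler_pM2l//; exact: rslope_le.
Qed.

(* The two bounds are the slopes of [V] over [x, r x] and [x / r, x]; for
   [rho = 0] both vanish. *)
Lemma rslope_periodic_bounds {R : realType} (r rho s : R) (p V : R -> R) :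
  1 < r -> 0 <= rho -> s = 1 \/ s = -1 ->
  (forall x, 0 < x -> 0 < p x) -> (forall x, 0 < x -> p (x * r) = p x) ->
  (forall x, 0 < x -> V x = s * (x `^ rho * p x)) ->
  slopes_nondecreasing V -> (forall x, 0 < x -> V y @[y --> x^'+] --> V x) ->
  exists m M, [/\ 0 < rho -> 0 < m, rho = 0 -> m = 0 /\ M = 0 &
    forall x, 0 < x -> m * p x <= s * x `^ (1 - rho) * rslope V x <= M * p x].
Proof.
move=> r1 rho0 s1 p0 pr VE cV rV; have r0 : 0 < r by exact: lt_trans r1.
pose k := r `^ rho.
have k0 : 0 < k by exact: powR_gt0.
have k1 : 0 < rho -> 1 < k.
  by move=> rho_gt0; rewrite /k /powR gt_eqF// -expR0 ltr_expR mulr_gt0// ln_gt0.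
pose c2 := (k - 1) / (r - 1).
pose c1 := (1 - k^-1) / (1 - r^-1).
have c2_gt0 : 0 < rho -> 0 < c2 by move=> /k1 ?; rewrite divr_gt0// subr_gt0.
have c1_gt0 : 0 < rho -> 0 < c1.
  by move=> /k1 ?; rewrite divr_gt0// subr_gt0 invf_lt1.
have c0 : rho = 0 -> c1 = 0 /\ c2 = 0.
  by move=> rhoE; rewrite /c1 /c2 /k rhoE powRr0 invr1 subrr !mul0r.
have ss : s * s = 1 by case: s1 => ->; rewrite ?mulrNN mulr1.
have Vr x : 0 < x -> V (r * x) = k * V x.
  move=> x0; rewrite !VE ?mulr_gt0// powRM ?ltW// [r * x]mulrC pr// /k; ring.
have VrV x : 0 < x -> V (x / r) = k^-1 * V x.
  move=> x0; have := Vr _ (divr_gt0 x0 r0); rewrite [r * _]mulrC divfK ?gt_eqF// => ->.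
  by rewrite mulKf// gt_eqF.
have xV x : 0 < x -> s * x `^ (1 - rho) * V x / x = p x.
  move=> x0; rewrite VE// powRB; last by rewrite (gt_eqF x0) implybT.
  rewrite powRr1 ?ltW//.
  have /lt0r_neq0 xr : 0 < x `^ rho by exact: powR_gt0.
  have /lt0r_neq0 x_n0 := x0.
  transitivity (s * s * p x); last by rewrite ss mul1r.
  by field; rewrite xr x_n0.
have bounds x : 0 < x -> c1 * V x / x <= rslope V x <= c2 * V x / x.
  move=> x0; have xx : x / r < x by rewrite ltr_pdivrMr// ltr_pMr.
  have xx' : x < r * x by rewrite ltr_pMl.
  have := slope_le_rslope V (x / r) x x cV (divr_gt0 x0 r0) xx (lexx _).
  have := rslope_le_slope V x (r * x) cV (rV x x0) x0 xx'.
  rewrite /slope Vr// VrV//.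
  have /lt0r_neq0 x_n0 := x0; have /lt0r_neq0 r_n0 := r0; have /lt0r_neq0 k_n0 := k0.
  have r1_n0 : r - 1 != 0 by rewrite subr_eq0 gt_eqF.
  have rxx : r * x - x != 0 by rewrite subr_eq0 gt_eqF.
  have xrx : x * r - x != 0 by rewrite mulrC.
  have -> : (k * V x - V x) / (r * x - x) = c2 * V x / x.
    by rewrite /c2; field; rewrite ?rxx ?xrx ?r1_n0 ?x_n0.
  have -> : (V x - k^-1 * V x) / (x - x / r) = c1 * V x / x.
    by rewrite /c1; field; rewrite ?rxx ?xrx ?k_n0 ?r_n0 ?x_n0 ?r1_n0.
  by move=> -> ->.
have t0 x : 0 < x -> 0 < x `^ (1 - rho) by exact: powR_gt0.
case: s1 => sE.
  exists c1, c2; split=> // x x0; have /andP[b1 b2] := bounds x x0.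
  rewrite -(xV x x0) sE !mul1r; apply/andP; split.
    by rewrite [leLHS](_ : _ = x `^ (1 - rho) * (c1 * V x / x)) ?ler_pM2l ?t0//; ring.
  by rewrite [leRHS](_ : _ = x `^ (1 - rho) * (c2 * V x / x)) ?ler_pM2l ?t0//; ring.
(* For [s = -1], multiplication by [s] reverses the inequalities, so the constants swap. *)
exists c2, c1; split=> // [/c0[]//|x x0]; have /andP[b1 b2] := bounds x x0.
rewrite -(xV x x0) sE !mulN1r; apply/andP; split.
  by rewrite [leLHS](_ : _ = - (x `^ (1 - rho) * (c2 * V x / x))) ?mulNr ?lerN2 ?ler_pM2l ?t0//; ring.
by rewrite [leRHS](_ : _ = - (x `^ (1 - rho) * (c1 * V x / x))) ?mulNr ?lerN2 ?ler_pM2l ?t0//; ring.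
Qed.

(** * From the asymptotics of [U] along geometric sequences to those of [u] *)

Theorem theorem3 (R : realType) (r rho : R) (l u U p : R -> R)
    (hr : 1 < r) (hrho : 0 <= rho)
    (hl : slowly_varying l)
    (u_ge0 : forall x : R, 0 <= x -> 0 <= u x)
    (u_meas : measurable_fun (`[0, +oo[ : set R) u)
    (U_fin : forall x : R, 0 <= x ->
      (\int[lebesgue_measure]_(y in `[0%R, x]) (u y)%:E < +oo)%E)
    (U_def : forall x : R, 0 <= x ->
      U x = \int[lebesgue_measure]_(y in `[0, x]) u y)
    (u_mono : ultimately_monotone u)
    (hp : log_periodic r p)
    (U_lim : forall z : R, continuity_points p z ->
      U (r ^+ n * z) / ((r ^+ n * z) `^ rho * l (r ^+ n * z))
        @[n --> \oo] --> p z) :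
  exists p0 : R -> R,
    [/\ 0 < rho ->
          log_periodic r p0 /\ forall x : R, 0 < x -> p x = Bop rho p0 x,
        rho = 0 -> forall x : R, 0 < x -> p0 x = 0,
        forall z : R, continuity_points p0 z ->
          u (r ^+ n * z) / ((r ^+ n * z) `^ (rho - 1) * l (r ^+ n * z))
            @[n --> \oo] --> p0 z &
        (forall x : R, 0 < x -> {for x, continuous p0}) ->
          (0 < rho ->
             asymp_equiv u (fun x => x `^ (rho - 1) * l x * p0 x)) /\
          (rho = 0 ->
             little_o u (fun x => x `^ (rho - 1) * l x))].
Proof.
have r0 : 0 < r by exact: lt_trans hr.
have [l0 l_meas l_lim] := hl.
have [p_gt0 p_bnd p_rc p_inf p_per] := hp.
have r_oo := cvg_exprn_pinfty r hr.
have rn0 n : 0 < r ^+ n by exact: exprn_gt0.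
(* The sign [s] makes [s * u] ultimately nondecreasing. *)
have [s [x0 [s1 x00 su]]] : exists s x0 : R, [/\ s = 1 \/ s = -1, 0 <= x0 &
    forall x y, x0 <= x -> x <= y -> s * u x <= s * u y].
  have [x0 x00 [u_nd|u_ni]] := u_mono; [exists 1, x0|exists (-1), x0]; split=> //.
  - by left.
  - move=> x y x0x xy; rewrite !mul1r; apply: u_nd => //; rewrite in_itv/= andbT//.
    exact: le_trans xy.
  - by right.
  - move=> x y x0x xy; rewrite !mulN1r lerN2; apply: u_ni => //; rewrite in_itv/= andbT//.
    exact: le_trans xy.
have ss : s * s = 1 by case: s1 => ->; rewrite ?mulrNN mulr1.
have s_n0 : s != 0 by case: s1 => ->; rewrite ?oppr_eq0 oner_eq0.
(* The norming does not depend on [z], so dividing by it preserves convexity in [z]. *)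
pose a n := (r ^+ n) `^ rho * l (r ^+ n).
have a0 n : 0 < a n by rewrite mulr_gt0 ?powR_gt0 ?l0.
pose F n z := s * U (r ^+ n * z) / a n.
pose g n z := s * r ^+ n * u (r ^+ n * z) / a n.
pose V z := s * (z `^ rho * p z).
have Fg : eventually_slopes F g.
  move=> b b0; near=> n => x y bx xy.
  have rx : x0 <= r ^+ n * x.
    apply: (@le_trans _ _ (r ^+ n * b)); last by rewrite ler_pM2l.
    rewrite -ler_pdivrMr//; near: n; move/cvgryPge: r_oo; exact.
  have rxy : r ^+ n * x < r ^+ n * y by rewrite ltr_pM2l.
  have /andP[I1 I2] := integral_slope u U x0 s x00 u_ge0 u_meas U_fin U_def su s1 _ _ rx rxy.
  have yx : 0 < y - x by rewrite subr_gt0.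
  have an0 : 0 < (a n)^-1 by rewrite invr_gt0.
  have -> : slope (F n) x y = s * (U (r ^+ n * y) - U (r ^+ n * x)) / a n / (y - x).
    by rewrite /slope /F; congr (_ / _); ring.
  rewrite ler_pdivlMr// ler_pdivrMr//; apply/andP; split.
    rewrite [leLHS](_ : _ = s * u (r ^+ n * x) * (r ^+ n * y - r ^+ n * x) / a n).
      by rewrite ler_pM2r.
    by rewrite /g; ring.
  rewrite [leRHS](_ : _ = s * u (r ^+ n * y) * (r ^+ n * y - r ^+ n * x) / a n).
    by rewrite ler_pM2r.
  by rewrite /g; ring.
have rV x : 0 < x -> V y @[y --> x^'+] --> V x.
  move=> x_gt0; apply: cvgM; first exact: cvg_cst.
  apply: cvgM; last exact: p_rc.
  by apply: cvg_at_right_filter; exact: powR_continuous.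
have FV x : 0 < x -> F n x @[n --> \oo] --> V x.
  apply: convex_cvg Fg rV _ x => b c b0 bc.
  have [y /andP[b_y yc] py] := right_continuous_dense_continuous p b c p_rc b0 bc.
  exists y; first exact/andP.
  have y0 : 0 < y by exact: lt_trans b_y.
  have lim_p := U_lim y (conj y0 py).
  have lim_l : l (y * r ^+ n) / l (r ^+ n) @[n --> \oo] --> (1 : R).
    exact: (cvg_comp _ _ r_oo (l_lim y y0)).
  (* The last factor tends to 1 and replaces [l (r ^+ n * y)] by [l (r ^+ n)] in the norming. *)
  have : s * (y `^ rho * (U (r ^+ n * y) / ((r ^+ n * y) `^ rho * l (r ^+ n * y)))) *
      (l (y * r ^+ n) / l (r ^+ n)) @[n --> \oo] --> V y * 1.
    apply: cvgM lim_l; apply: cvgM; first exact: cvg_cst.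
    by apply: cvgM; [exact: cvg_cst|exact: lim_p].
  rewrite mulr1; apply: cvg_trans; apply: near_eq_cvg; apply: nearW => n.
  rewrite /F /a powRM ?ltW// [y * _]mulrC.
  have /lt0r_neq0 h1 := powR_gt0 rho y0.
  have /lt0r_neq0 h2 := powR_gt0 rho (rn0 n).
  have /lt0r_neq0 h3 := l0 _ (rn0 n).
  have /lt0r_neq0 h4 := l0 _ (mulr_gt0 (rn0 n) y0).
  by field; rewrite ?h1 ?h2 ?h3 ?h4.
have cV := convex_limit _ _ _ Fg FV.
have VE x : 0 < x -> V x = s * (x `^ rho * p x) by [].
have [m [M [m_gt0 mM0 p0_bounds]]] :=
  rslope_periodic_bounds r rho s p V hr hrho s1 p_gt0 p_per VE cV rV.
pose p0 x := s * x `^ (1 - rho) * rslope V x.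
have powK x : 0 < x -> x `^ (rho - 1) * x `^ (1 - rho) = 1.
  by move=> x_gt0; rewrite -powRD ?(gt_eqF x_gt0) ?implybT// addrC subrKA subrr powRr0.
have k0 : 0 < r `^ rho by exact: powR_gt0.
have Vr y : 0 < y -> V (r * y) = r `^ rho * V y.
  by move=> y0; rewrite /V powRM ?ltW// [r * y]mulrC p_per//; ring.
have p0_per x : 0 < x -> p0 (x * r) = p0 x.
  move=> x_gt0; rewrite /p0 [x * r]mulrC (rslope_scale V r _ _ cV r0 k0 Vr)// powRM ?ltW//.
  have -> : r `^ rho / r = r `^ (rho - 1).
    by rewrite powRB ?(gt_eqF r0) ?implybT// powRr1 ?ltW.
  rewrite (_ : _ * _ = s * (r `^ (rho - 1) * r `^ (1 - rho)) * x `^ (1 - rho) * rslope V x).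
    by rewrite powK// mulr1.
  by ring.
have p0_rc x : 0 < x -> p0 y @[y --> x^'+] --> p0 x.
  move=> x_gt0; apply: cvgM; last exact: rslope_right_continuous.
  apply: cvgM; first exact: cvg_cst.
  by apply: cvg_at_right_filter; exact: powR_continuous.
have p0_cont z : 0 < z -> {for z, continuous p0} -> {for z, continuous (rslope V)}.
  move=> z0 p0z.
  (* As [s * s = 1], the definition of [p0] can be inverted at positive points, which suffices near
     [z]. *)
  have sp0 x : 0 < x -> s * x `^ (rho - 1) * p0 x = rslope V x.
    move=> x_gt0; rewrite /p0.
    rewrite (_ : _ * _ = (s * s) * (x `^ (rho - 1) * x `^ (1 - rho)) * rslope V x); last by ring.
    by rewrite ss powK// !mul1r.
  suff : rslope V x @[x --> z] --> s * z `^ (rho - 1) * p0 z by rewrite sp0.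
  have : s * x `^ (rho - 1) * p0 x @[x --> z] --> s * z `^ (rho - 1) * p0 z.
    apply: cvgM p0z; apply: cvgM; first exact: cvg_cst.
    exact: powR_continuous.
  apply: cvg_trans; apply: near_eq_cvg; near=> x; apply/esym; rewrite sp0//.
  by near: x; exact: lt_nbhsr.
pose Q x := u x / (x `^ (rho - 1) * l x).
(* Freezing the first coordinate at [z] gives the limit along [r ^+ n * z]; the joint form feeds the
   compactness argument. *)
have Qcvg z : 0 < z -> {for z, continuous p0} ->
    Q (r ^+ wn.2 * wn.1) @[wn --> filter_prod (nbhs z) \oo] --> p0 z.
  move=> z0 /(p0_cont z z0) cz.
  have lim_g := derivative_joint_cvg F g V z Fg FV z0 cz.
  have lim_l := slowly_varying_joint_cvg l r z hl hr z0.
  have lim_pow : wn.1 `^ (1 - rho) @[wn --> filter_prod (nbhs z) \oo] --> z `^ (1 - rho).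
    by apply: (cvg_comp fst (fun x : R => x `^ (1 - rho)) _ (powR_continuous _ _ z0)); exact: cvg_fst.
  have : s * wn.1 `^ (1 - rho) * g wn.2 wn.1 * (l (r ^+ wn.2 * wn.1) / l (r ^+ wn.2))^-1
      @[wn --> filter_prod (nbhs z) \oo] --> p0 z * 1^-1.
    apply: cvgM; last by apply: cvgV => //; exact: oner_neq0.
    by apply: cvgM lim_g; apply: cvgM => //; exact: cvg_cst.
  rewrite invr1 mulr1; apply: cvg_trans; apply: near_eq_cvg.
  exists ([set w | 0 < w], setT); first by split; [exact: lt_nbhsr|exact: filterT].
  move=> [w n] /= [w0 _]; rewrite /Q /g /a.
  have -> : (r ^+ n * w) `^ (rho - 1) = (r ^+ n) `^ rho / r ^+ n * (w `^ (1 - rho))^-1.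
    rewrite powRM ?ltW//; congr (_ * _).
      by rewrite powRB ?(gt_eqF (rn0 n)) ?implybT// powRr1 ?ltW.
    by rewrite -powRN opprB.
  have /lt0r_neq0 h1 := powR_gt0 (1 - rho) w0.
  have /lt0r_neq0 h2 := powR_gt0 rho (rn0 n).
  have /lt0r_neq0 h3 := l0 _ (rn0 n).
  have /lt0r_neq0 h4 := l0 _ (mulr_gt0 (rn0 n) w0).
  have /lt0r_neq0 h5 := rn0 n.
  transitivity (s * s * (r ^+ n * w `^ (1 - rho) * u (r ^+ n * w) /
      ((r ^+ n) `^ rho * l (r ^+ n * w)))).
    by field; rewrite ?h1 ?h2 ?h3 ?h4 ?h5.
  by rewrite ss; field; rewrite ?h1 ?h2 ?h3 ?h4 ?h5.
have p_ge x : 0 < x -> inf (p @` `[1, r]) <= p x.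
  move=> x_gt0.
  (* Multiplying by [r ^+ k] moves [x] beyond 1; dividing by [r ^+ n] then brings it back into
     [[1, r]]. *)
  have /cvgryPge /(_ x^-1) [k _ Hk] := r_oo.
  have rkx1 : 1 <= r ^+ k * x.
    by rewrite -ler_pdivrMr// mul1r; exact: (Hk k (leqnn k)).
  have [n /andP[nx xn]] := exists_exprn_itv r (r ^+ k * x) hr rkx1.
  have rkx0 : 0 < r ^+ k * x by rewrite mulr_gt0.
  rewrite -(periodic_exprn r p k x r0 p_per x_gt0).
  rewrite -[r ^+ k * x](mulfVK (lt0r_neq0 (rn0 n))) [_ * r ^+ n]mulrC periodic_exprn//; last first.
    by rewrite divr_gt0.
  apply: ge_inf; first by exists 0 => ? [y /=]; rewrite in_itv/= => /andP[y1 _] <-;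
    rewrite ltW// p_gt0// (lt_le_trans _ y1).
  exists (r ^+ k * x / r ^+ n) => //=.
  by rewrite in_itv/= ler_pdivlMr// mul1r nx/= ler_pdivrMr// -exprS ltW.
have p0_ge0 x : 0 < x -> 0 <= p0 x.
  move=> x_gt0; have /andP[p0m _] := p0_bounds x x_gt0; apply: le_trans p0m.
  have p_x := p_gt0 x x_gt0.
  have [rho_gt0|rho_le0] := ltP 0 rho; first by rewrite mulr_ge0 ?ltW// m_gt0.
  by have [-> _] := mM0 (le_anti (introT andP (conj rho_le0 hrho))); rewrite mul0r.
exists p0; split.
- move=> rho_gt0; have {}m_gt0 := m_gt0 rho_gt0; split.
    split=> //.
    + move=> x x_gt0; have /andP[p0m _] := p0_bounds x x_gt0; apply: lt_le_trans p0m.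
      by rewrite mulr_gt0// p_gt0.
    + have [N [_ HN]] := p_bnd.
      (* The added 1 is there because [HN] bounds [p] only by numbers strictly above [N]. *)
      exists (`|M| * (`|N| + 1)); split; first exact: num_real.
      move=> K KM x /= x_in; apply: le_trans (ltW KM).
      have x_gt0 : 0 < x by move: x_in; rewrite in_itv/= andbT.
      rewrite ger0_norm ?p0_ge0//; have /andP[_ p0M] := p0_bounds x x_gt0.
      apply: (le_trans p0M); apply: (le_trans (ler_norm _)); rewrite normrM ler_wpM2l//.
      by apply: HN => //; rewrite ltr_pwDr// ler_norm.
    + apply: (@lt_le_trans _ _ (m * inf (p @` `[1, r]))); first by rewrite mulr_gt0.
      apply: lb_le_inf; first by exists (p0 1), 1 => //=; rewrite in_itv/= lexx ltW.
      move=> ? [x /=]; rewrite in_itv/= => /andP[x1 _] <-.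
      have x_gt0 : 0 < x by exact: lt_le_trans x1.
      have /andP[p0m _] := p0_bounds x x_gt0; apply: le_trans p0m.
      by rewrite ler_pM2l// p_ge.
  move=> x x_gt0; rewrite /Bop.
  (* The powers of [y] cancel and leave the derivative of [s * V], a function that tends to 0 at 0
     along [b]. *)
  have -> : \int[lebesgue_measure]_(y in `]0, x]) (y `^ (rho - 1) * p0 y) =
      \int[lebesgue_measure]_(y in `]0, x]) (s * rslope V y).
    apply: eq_Rintegral => y; rewrite inE/= in_itv/= => /andP[y_gt0 _].
    rewrite /p0 (_ : _ * _ = s * (y `^ (rho - 1) * y `^ (1 - rho)) * rslope V y); last by ring.
    by rewrite powK// mulr1.
  (* The exponent [n.+1] makes [b n < x] strict already at [n = 0]. *)
  pose b n := x / r ^+ n.+1.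
  have b_gt0 n : 0 < b n by rewrite divr_gt0.
  have b_lt n : b n < x.
    by rewrite ltr_pdivrMr// ltr_pMr// exprn_egt1.
  have rslope_nd n y z : b n <= y -> y <= z -> z <= x -> rslope V y <= rslope V z.
    by move=> bny yz _; apply: rslope_nondecreasing => //; exact: lt_le_trans bny.
  have rslope_i n := nondecreasing_itv_integrable _ _ _ (rslope_nd n) (ltW (b_lt n)).
  rewrite (integral_itv0_limit _ (fun y => s * V y) _ b).
  - rewrite /V (_ : _ * _ = s * s * (x `^ (- rho) * x `^ rho) * p x); last by ring.
    by rewrite ss mul1r -powRD ?(gt_eqF x_gt0) ?implybT// addNr powRr0 mul1r.
  - move=> t t0; have := p0_ge0 t t0; rewrite /p0 mulrAC pmulr_lge0//; exact: powR_gt0.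
  - by move=> n; rewrite b_gt0 b_lt.
  - by move=> n; rewrite /b ler_pM2l// lef_pV2 ?posrE// ler_eXn2l.
  - have := @cvg_geometric R x r^-1.
    rewrite gtr0_norm ?invr_gt0// invf_lt1// => /(_ hr).
    rewrite -cvg_shiftS.
    by under [X in X -> _]eq_cvg do rewrite /= exprVn.
  (* Along [b] the values of [V] form a geometric sequence, whose ratio is below 1 because
     [rho > 0]. *)
  - have VrV n : V (x / r ^+ n) = V x * (r `^ rho)^-1 ^+ n.
      elim: n => [|n IHn]; first by rewrite !expr0 divr1 mulr1.
      have xrn0 : 0 < x / r ^+ n.+1 by rewrite divr_gt0.
      have := Vr _ xrn0.
      have -> : r * (x / r ^+ n.+1) = x / r ^+ n.
        by rewrite exprS; field; rewrite !lt0r_neq0.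
      rewrite IHn => VE'; apply: (mulfI (lt0r_neq0 k0)).
      by rewrite -VE' [_^-1 ^+ n.+1]exprS mulrCA mulVKf// lt0r_neq0.
    have := @cvg_geometric R (s * V x) (r `^ rho)^-1.
    rewrite gtr0_norm ?invr_gt0// invf_lt1//.
    have -> : 1 < r `^ rho by rewrite /powR gt_eqF// -expR0 ltr_expR mulr_gt0// ln_gt0.
    move=> /(_ isT); rewrite -cvg_shiftS.
    by under [X in X -> _]eq_cvg do rewrite /= -mulrA -VrV.
  - by move=> n; exact: (@integrableZl _ _ _ lebesgue_measure _ (measurable_itv _) s _ (rslope_i n)).
  - move=> n; rewrite RintegralZl//.
    rewrite (integral_nondecreasing_slope _ V _ _ (rslope_nd n))//.
      by rewrite mulrBr.
    move=> y z bny yz _; have y0 : 0 < y by exact: lt_le_trans bny.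
    apply/andP; split; last exact: slope_le_rslope.
    by apply: rslope_le_slope => //; exact: rV.
- move=> rhoE x x_gt0; have [m0 M0] := mM0 rhoE; have := p0_bounds x x_gt0.
  by rewrite m0 M0 !mul0r => /le_anti.
- move=> z [z0 cz]; have pairz : (z, n) @[n --> \oo] --> filter_prod (nbhs z) \oo.
    move=> A [[B C] /= [zB [N _ NC]] BC]; exists N => // n Nn; apply: BC.
    by split=> /=; [exact: nbhs_singleton|exact: NC].
  exact: (cvg_comp _ _ pairz (Qcvg z z0 cz)).
- move=> cp0.
  have Qp0 : Q x - p0 x @[x --> +oo] --> 0.
    by apply: (joint_cvg_pinfty r) => // z z0; apply: Qcvg => //; exact: cp0.
  split=> [rho_gt0|rhoE].
  + rewrite /asymp_equiv.
    (* A uniform positive lower bound for [p0] turns the vanishing difference [Q x - p0 x] into a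
       ratio tending to 1. *)
    pose d := m * inf (p @` `[1, r]).
    have d0 : 0 < d by rewrite mulr_gt0// m_gt0.
    have p0d x : 0 < x -> d <= p0 x.
      move=> x_gt0; have /andP[p0m _] := p0_bounds x x_gt0; apply: le_trans p0m.
      by rewrite ler_pM2l ?m_gt0// p_ge.
    apply/cvgrPdist_lt => e e0; have ed0 : 0 < e * d by rewrite mulr_gt0.
    move/cvgrPdist_lt : Qp0 => /(_ _ ed0) Qp0; near=> x.
    have x_gt0 : 0 < x by near: x; exact: nbhs_pinfty_gt.
    have px0 : 0 < p0 x by exact: lt_le_trans (p0d x x_gt0).
    have xn0 : x `^ (rho - 1) != 0 by rewrite gt_eqF// powR_gt0.
    have ln0 : l x != 0 by rewrite gt_eqF// l0.
    have pn0 : p0 x != 0 by rewrite gt_eqF.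
    have -> : 1 - u x / (x `^ (rho - 1) * l x * p0 x) = (0 - (Q x - p0 x)) / p0 x.
      by rewrite /Q; field; rewrite xn0 ln0 pn0.
    rewrite normrM normfV (gtr0_norm px0) ltr_pdivrMr//.
    apply: (@lt_le_trans _ _ (e * d)); first by near: x.
    by rewrite ler_pM2l// p0d.
  + apply/eqoP => e e0.
    move/cvgrPdist_lt : Qp0 => /(_ _ e0) Qp0; near=> x.
    have x_gt0 : 0 < x by near: x; exact: nbhs_pinfty_gt.
    have [m0 M0] := mM0 rhoE.
    have p0x : p0 x = 0.
      by have := p0_bounds x x_gt0; rewrite m0 M0 !mul0r => /le_anti.
    have xl0 : 0 < x `^ (rho - 1) * l x by rewrite mulr_gt0 ?powR_gt0 ?l0.
    have : `|0 - (Q x - p0 x)| < e by near: x.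
    rewrite p0x subr0 sub0r normrN /Q normrM normfV => /ltW.
    by rewrite ler_pdivrMr// normr_gt0 gt_eqF.
Unshelve. all: end_near. Qed.
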